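(* Let $(\mathbb{X},\|\cdot\|)$ be an infinite-dimensional real Banach space and let $\mathcal{B}=(e_n)_{n=1}^\infty$ be a normalized Schauder basis of $\mathbb{X}$. Then $\mathcal{B}$ has the PCCG property if and only if $\mathcal{B}$ is greedy.
   Context: Let $(e_n^* )_{n=1}^\infty$ be the biorthogonal functionals of the normalized ($\|e_n\|=1$) Schauder basis $\mathcal{B}$. For a finite set $A\subset\mathbb{N}$ write $|A|$ for its cardinality and $P_A(x)=\sum_{n\in A}e_n^*(x)e_n$; for signs $\eta=(\eta_n)_{n\in A}$ with $\eta_n\in\{\pm1\}$ write $1_{\eta A}=\sum_{n\in A}\eta_n e_n$. The symbol $[\,\cdot\,]$ denotes linear span and $d(x,Y)=\inf_{y\in Y}\|x-y\|$. Greedy basis: a greedy ordering of $x\in\mathbb{X}$ is an injective map $\rho:\mathbb{N}\to\mathbb{N}$ with $\{n:e_n^*(x)\ne0\}\subseteq\rho(\mathbb{N})$ and $|e^*_{\rho(j)}(x)|\ge|e^*_{\rho(i)}(x)|$ for $j\le i$; the corresponding $m$-th greedy approximant is $\mathcal{G}_m(x)=\sum_{j=1}^m e^*_{\rho(j)}(x)e_{\rho(j)}$. With $\sigma_m(x)=\inf\{d(x,[e_n:n\in A]):A\subset\mathbb{N},\ |A|=m\}$, the basis is greedy if there is a constant $C$ such that $\|x-\mathcal{G}_m(x)\|\le C\sigma_m(x)$ for all $x\in\mathbb{X}$, all $m\in\mathbb{N}$ and every $m$-th greedy approximant $\mathcal{G}_m(x)$ of $x$. PCCG property: for $x\in\mathbb{X}$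 and $m\in\mathbb{N}$ let $\mathscr{G}(x,1,m)$ be the collection of sets $\Gamma\subset\mathbb{N}$ with $|\Gamma|=m$ and $\min_{n\in\Gamma}|e_n^*(x)|\ge\max_{n\notin\Gamma}|e_n^*(x)|$, and let $\mathcal{D}_m(x)=\inf\{d(x,[1_{\eta A}]):A\subset\mathbb{N},\ \eta\in\{\pm1\}^A,\ |A|\le m\}$. The basis has the PCCG property if there is a constant $D>0$ such that $\|x-P_\Gamma(x)\|\le D\,\mathcal{D}_m(x)$ for all $x\in\mathbb{X}$, all $m\in\mathbb{N}$ and all $\Gamma\in\mathscr{G}(x,1,m)$. *)

(* Defs.v *)
From HB Require Import structures.
From mathcomp Require Import all_boot all_order all_algebra finmap.
From mathcomp Require Import all_classical all_reals all_analysis.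

Set Implicit Arguments.
Unset Strict Implicit.
Unset Printing Implicit Defensive.

Import Order.TTheory GRing.Theory Num.Theory.
Import numFieldNormedType.Exports.

Local Open Scope classical_set_scope.
Local Open Scope ring_scope.

(* Sequences are indexed from 0, so that e 0, e 1, ... are the vectors usually
   written e_1, e_2, ...; the integer m below is still required to be >= 1. *)

Definition lspan (R : realType) (X : lmodType R) (S : set X) : set X :=
  [set y | exists (k : nat) (a : 'I_k -> R) (v : 'I_k -> X),
      (forall i, S (v i)) /\ y = \sum_(i < k) a i *: v i].

Definition infinite_dimensional (R : realType) (X : lmodType R) : Prop :=
  ~ exists2 F : set X, finite_set F & lspan F = [set: X].

Section Bases.
Context {R : realType} {X : completeNormedModType R}.
Implicit Types (e : nat -> X) (x : X) (m n : nat).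

Definition dist_set x (Y : set X) : R := inf [set `|x - y| | y in Y].

Definition expansion e x : set (nat -> R) :=
  [set a | series (fun n => a n *: e n) @ \oo --> x].

Definition schauder_basis e : Prop := forall x, exists! a, expansion e x a.

Definition normalized e : Prop := forall n, `|e n| = 1.

(* The biorthogonal functional e_n^*. The default value 0 is irrelevant when
   e is a Schauder basis; no continuity is assumed. *)
Definition coefun e n x : R := xget (fun=> 0) (expansion e x) n.

Lemma coefun_expansion e x :
  schauder_basis e -> expansion e x (fun n => coefun e n x).
Proof. by move=> /(_ x)[a [xa _]]; exact: (xgetPex (fun=> 0) (ex_intro _ a xa)). Qed.

Lemma coefun_unique e x (a : nat -> R) :
  schauder_basis e -> expansion e x a -> forall n, coefun e n x = a n.
Proof.
move=> eB xa n; have [b [_ b_uniq]] := eB x.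
by rewrite -(b_uniq _ xa) (b_uniq _ (coefun_expansion eB)).
Qed.

Definition projset e (A : {fset nat}) x : X := \sum_(n <- A) coefun e n x *: e n.

Definition sign_family (A : {fset nat}) (eta : nat -> R) : Prop :=
  forall n, n \in A -> eta n = 1 \/ eta n = -1.

Definition signed_sum e (eta : nat -> R) (A : {fset nat}) : X :=
  \sum_(n <- A) eta n *: e n.

Definition greedy_ordering e x (rho : nat -> nat) : Prop :=
  [/\ injective rho,
      [set n | coefun e n x != 0] `<=` range rho
    & forall i j, (j <= i)%N -> `|coefun e (rho i) x| <= `|coefun e (rho j) x|].

Definition greedy_approx e x (rho : nat -> nat) m : X :=
  \sum_(j < m) coefun e (rho j) x *: e (rho j).

Definition sigma_err e m x : R :=
  inf [set dist_set x (lspan [set e n | n in [set` A]])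
      | A in [set A : {fset nat} | #|` A| = m]].

Definition greedy e : Prop :=
  exists C : R, forall x m (rho : nat -> nat), (0 < m)%N ->
    greedy_ordering e x rho -> `|x - greedy_approx e x rho m| <= C * sigma_err e m x.

(* The members of the collection G(x, 1, m). *)
Definition greedy_set e x m (G : {fset nat}) : Prop :=
  #|` G| = m /\
  forall n k, n \in G -> k \notin G -> `|coefun e k x| <= `|coefun e n x|.

Definition D_err e m x : R :=
  inf [set r | exists (A : {fset nat}) (eta : nat -> R),
      [/\ (#|` A| <= m)%N, sign_family A eta
        & r = dist_set x (lspan [set signed_sum e eta A])]].

Definition PCCG e : Prop :=
  exists2 D : R, 0 < D & forall x m (G : {fset nat}), (0 < m)%N ->
    greedy_set e x m G -> `|x - projset e G x| <= D * D_err e m x.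

End Bases.

(* Main.v *)
(** A greedy set [G] for [x] of size [m] consists of the first [m] values of some
greedy ordering, obtained by choosing iteratively an index of largest
remaining coefficient, and [sigma_m <= D_m]; hence greedy implies PCCG.

Conversely, let PCCG hold with constant [D].  Applying it to [x + a 1_A] with
[a] large gives [|x - P_A x| <= (1 + D) |x|].  Let [G] be greedy for [x], let
[y] be supported in [A] with [#A = #G], and let [t] separate the coefficients
of [x] on [G] from those off [G].  By convexity [|x - P_G x|] is at most the
maximum over signs [eta] of [|x - P_(A u G) x + t 1_(eta, A \ G)|].  This
vector is [w - P_(G \ A) w] for [w = x - P_A x + t 1_(eta, A \ G)], for which
[G \ A] is greedy, so PCCG bounds its norm by [(1 + D) |x - P_A x|], and
[x - P_A x = (x - y) - P_A (x - y)].  Identities between vectors are checked on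
coefficients, so continuity of the functionals [e_n^*] is never needed. *)
Require Import Defs.
From mathcomp Require Import all_boot all_order all_algebra finmap.
From mathcomp Require Import all_classical all_reals all_analysis.
From mathcomp Require Import ring lra.

Set Implicit Arguments.
Unset Strict Implicit.
Unset Printing Implicit Defensive.

Import Order.TTheory GRing.Theory Num.Theory.
Import numFieldNormedType.Exports.

Local Open Scope classical_set_scope.
Local Open Scope fset_scope.
Local Open Scope ring_scope.

Lemma exists_notin_fset (A : {fset nat}) : exists n, n \notin A.
Proof.
(* Each element of [A] is at most the sum of all of them. *)
exists (\sum_(i <- A) i).+1; apply/negP => nA.
have := leqnn (\sum_(i <- A) i).
by rewrite {1}(big_fsetD1 _ nA) /= addSn ltnNge leq_addr.
Qed.

(** * Coefficient functionals of a Schauder basis *)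

Section Coefficients.
Context {R : realType} {X : completeNormedModType R} (e : nat -> X).
Hypothesis eB : schauder_basis e.
Implicit Types (x y : X) (A G : {fset nat}) (n m : nat)
  (eta : nat -> R) (rho : nat -> nat).

(** The same linear combination of the two expansions converges to [k *: x + y], and expansions are
    unique. *)
Lemma coefunP n k x y :
  coefun e n (k *: x + y) = k * coefun e n x + coefun e n y.
Proof.
apply: (@coefun_unique _ _ _ _ (fun n => k * coefun e n x + coefun e n y)) => //.
rewrite /expansion /=.
have -> : series (fun n => (k * coefun e n x + coefun e n y) *: e n) =
    (fun n => k *: series (fun n => coefun e n x *: e n) n
              + series (fun n => coefun e n y *: e n) n).
  apply/funext => N; rewrite /series /= scaler_sumr -big_split /=.
  by apply: eq_bigr => i _; rewrite scalerDl scalerA.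
by apply: cvgD; [apply: cvgZl_tmp|]; exact: (coefun_expansion eB).
Qed.

Lemma coefun_basis n k : coefun e n (e k) = (n == k)%:R.
Proof.
apply: (@coefun_unique _ _ _ _ (fun n => (n == k)%:R)) => //.
rewrite /expansion /=; apply: cvg_near_cst.
exists k.+1 => // N /= kN; apply/eqP.
rewrite /series /= big_mkord (bigD1 (Ordinal kN)) //= eqxx scale1r big1 ?addr0 //.
by move=> i; rewrite -val_eqE /= => /negPf ->; rewrite scale0r.
Qed.

Lemma coefun0 n : coefun e n 0 = 0.
Proof. by have := coefunP n (-1) 0 0; rewrite scaler0 addr0 mulN1r addNr. Qed.

Lemma coefunD n x y : coefun e n (x + y) = coefun e n x + coefun e n y.
Proof. by have := coefunP n 1 x y; rewrite scale1r mul1r. Qed.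

Lemma coefunZ n (k : R) x : coefun e n (k *: x) = k * coefun e n x.
Proof. by have := coefunP n k x 0; rewrite addr0 coefun0 addr0. Qed.

Lemma coefunB n x y : coefun e n (x - y) = coefun e n x - coefun e n y.
Proof. by rewrite coefunD -scaleN1r coefunZ mulN1r. Qed.

Lemma coefun_sum n I (r : seq I) (F : I -> X) :
  coefun e n (\sum_(i <- r) F i) = \sum_(i <- r) coefun e n (F i).
Proof. exact: (big_morph _ (coefunD n) (coefun0 n)). Qed.

Lemma coefun_lincomb n (A : {fset nat}) (a : nat -> R) :
  coefun e n (\sum_(i <- A) a i *: e i) = if n \in A then a n else 0.
Proof.
rewrite coefun_sum; under eq_bigr do rewrite coefunZ coefun_basis.
case: ifPn => nA.
  rewrite (bigD1_seq n) ?fset_uniq //= eqxx mulr1 big1 ?addr0 // => i.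
  by rewrite eq_sym => /negPf ->; rewrite mulr0.
rewrite big_seq big1 // => i iA; case: eqP => [ni|]; last by rewrite mulr0.
by rewrite ni iA in nA.
Qed.

Lemma coefun_projset n A x :
  coefun e n (projset e A x) = if n \in A then coefun e n x else 0.
Proof. exact: coefun_lincomb. Qed.

Lemma coefun_signed_sum n A eta :
  coefun e n (signed_sum e eta A) = if n \in A then eta n else 0.
Proof. exact: coefun_lincomb. Qed.

Lemma coefun_inj x y : (forall n, coefun e n x = coefun e n y) -> x = y.
Proof.
move=> xy; have := coefun_expansion (x := x) eB.
under [X in expansion _ _ X]funext do rewrite xy.
move=> /(cvg_unique _); apply; [exact: norm_hausdorff|].
exact: (coefun_expansion eB).
Qed.

Hypothesis e1 : normalized e.

(** The terms of a convergent series tend to 0; normalization turns their norms into absolute values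
    of coefficients. *)
Lemma coefun_cvg0 x : coefun e n x @[n --> \oo] --> 0.
Proof.
have /cvgP/cvg_series_cvg_0 xe := coefun_expansion (x := x) eB.
apply/norm_cvg0P; move/cvg_norm : xe; rewrite normr0.
by under eq_fun do rewrite normrZ e1 mulr1.
Qed.

Lemma coefun_bounded x : exists2 M, 0 <= M & forall n, `|coefun e n x| <= M.
Proof.
have /cvgP/cvg_seq_bounded/pinfty_ex_gt0[M M0 xM] := @coefun_cvg0 x.
by exists M => [|n]; [exact: ltW | exact: xM].
Qed.

(** * Greedy sets and greedy orderings *)

Lemma coefun_argmax x (A : {fset nat}) : exists2 k, k \notin A &
  forall j, j \notin A -> `|coefun e j x| <= `|coefun e k x|.
Proof.
(* If every coefficient off [A] vanishes, any index off [A] works. Otherwise convergence to 0 leaves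
   only finitely many competitors for [j0]. *)
have [[j0 j0A cj0]|c0] := pselect (exists2 j, j \notin A & coefun e j x != 0); last first.
  have [k kA] := exists_notin_fset A.
  exists k => // j jA; suff -> : coefun e j x = 0 by rewrite normr0.
  by apply/eqP; apply: contra_notT c0 => ?; exists j.
have [N _ xN] : \forall n \near \oo, `|coefun e n x| < `|coefun e j0 x|.
  by apply: (cvgr0_norm_lt _ (@coefun_cvg0 x)); rewrite normr_gt0.
have j0N : (j0 < N)%N by rewrite ltnNge; apply/negP => /xN /=; rewrite ltxx.
have [k kA kmax] := @arg_maxP _ _ _ (Ordinal j0N) (fun i => val i \notin A)
  (fun i => `|coefun e (val i) x|) j0A.
exists (val k) => // j jA; have [jN|Nj] := ltnP j N.
  exact: (kmax (Ordinal jN)).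
by apply: le_trans (kmax (Ordinal j0N) j0A); apply: ltW; exact: xN.
Qed.

(** One greedy choice, with [A] the set of indices already taken. The last clause breaks ties in
    favour of [G] until it is exhausted. *)
Lemma greedy_set_step x m G (A : {fset nat}) : greedy_set e x m G ->
  exists k, [/\ k \notin A,
    forall j, j \notin A -> `|coefun e j x| <= `|coefun e k x|
    & ~~ (G `<=` A) -> k \in G].
Proof.
move=> [_ Gmax]; have [GA|GA] := boolP (G `<=` A).
  by have [k kA kmax] := coefun_argmax x A; exists k; split.
case/fsubsetPn : GA => n0 n0G n0A.
(* As [G] is greedy, maximizing over [G `\` A] maximizes over all of [~` A]. *)
have n0GA : n0 \in G `\` A by rewrite inE n0A.
have [k _ kmax] := @arg_maxP _ _ _ [` n0GA] xpredT (fun i => `|coefun e (val i) x|) isT.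
have /[!inE]/andP[kA kG] := valP k.
exists (val k); split=> // j jA; have [jG|jG] := boolP (j \in G).
  have jGA : j \in G `\` A by rewrite inE jA.
  exact: (kmax [` jGA]).
exact: Gmax.
Qed.

Lemma greedy_set_ordering x m G : greedy_set e x m G ->
  exists2 rho, greedy_ordering e x rho & greedy_approx e x rho m = projset e G x.
Proof.
move=> gG; have [f fP] := choice (fun A => greedy_set_step A gG).
pose S k := iter k (fun A => f A |` A) fset0.
pose rho k := f (S k).
have SS k : S k.+1 = rho k |` S k by [].
have rhoS k : rho k \notin S k by have [] := fP (S k).
have S_mono i j : (i <= j)%N -> S i `<=` S j.
  move=> /subnK <-; elim: (j - i)%N => [|k ih]; first exact: fsubset_refl.
  by rewrite addSn SS (fsubset_trans ih) // fsubsetU1.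
have mem_S i j : (i < j)%N -> rho i \in S j.
  by move=> /S_mono/fsubsetP; apply; rewrite SS !inE eqxx.
have rho_inj : injective rho.
  move=> i j rij; have [ij|ji|//] := ltngtP i j.
    by have := rhoS j; rewrite -rij mem_S.
  by have := rhoS i; rewrite rij mem_S.
have cS k : #|` S k| = k.
  by elim: k => [|k ih]; rewrite ?cardfs0 // SS cardfsU1 rhoS ih.
have rho_mono i j : (j <= i)%N -> `|coefun e (rho i) x| <= `|coefun e (rho j) x|.
  move=> ji; have [_ + _] := fP (S j); apply.
  by apply: contra (rhoS i) => /(fsubsetP (S_mono _ _ ji)).
(* Before stage [m], the set [S k] is too small to contain [G], so the next choice falls in [G]. *)
have SG k : (k <= m)%N -> S k `<=` G.
  elim: k => [|k ih] km; first exact: fsub0set.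
  rewrite SS fsubUset fsub1set ih ?(ltnW km) // andbT.
  have [_ _] := fP (S k); apply; apply/negP => /fsubset_leq_card.
  by rewrite cS gG.1 leqNgt km.
have SmG : S m = G.
  by apply/eqP; rewrite eqEfcard SG //= cS gG.1.
exists rho; first split=> //.
  move=> n /= cn0; apply: contrapT => nrho.
  have nS k : n \notin S k.
    elim: k => [|k ih] //; rewrite SS !inE negb_or ih andbT.
    by apply/eqP => nk; apply: nrho; exists k.
  have [N _ xN] : \forall k \near \oo, `|coefun e k x| < `|coefun e n x|.
    by apply: (cvgr0_norm_lt _ (@coefun_cvg0 x)); rewrite normr_gt0.
  (* Every chosen index has a coefficient at least that of [n], so it is below [N]. *)
  have : S N.+1 `<=` seq_fset tt (iota 0 N).
    apply/fsubsetP => k kS; rewrite seq_fsetE mem_iota /= add0n ltnNge.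
    apply/negP => /xN /=; rewrite ltNge => /negP; apply.
    have [i ->] : exists i, k = rho i.
      move: kS; elim: {1}N.+1 => // i ih; rewrite SS !inE => /orP[/eqP ->|/ih//].
      by exists i.
    by have [_ + _] := fP (S i); apply.
  move=> /fsubset_leq_card; rewrite cS size_seq_fset undup_id ?iota_uniq //.
  by rewrite size_iota ltnn.
rewrite /greedy_approx /projset -SmG.
elim: m {gG SG SmG} => [|k ih]; first by rewrite big_ord0 big_seq_fset0.
by rewrite SS big_fsetU1 ?rhoS //= -ih big_ord_recr addrC.
Qed.

Lemma greedy_ordering_set x rho m : greedy_ordering e x rho ->
  exists2 G, greedy_set e x m G & greedy_approx e x rho m = projset e G x.
Proof.
move=> [rho_inj supp mono].
exists [fset rho i | i in iota 0 m]; last first.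
  rewrite /projset big_imfset /=; last by move=> ? ? _ _ /rho_inj.
  have := big_mkord xpredT (fun j => coefun e (rho j) x *: e (rho j)).
  by rewrite /index_iota undup_id ?iota_uniq // => /(_ 0 +%R m); rewrite subn0 => ->.
split; first by rewrite card_imfset //= undup_id ?iota_uniq // size_iota.
move=> n k /imfsetP[i /= + ->] kG; rewrite mem_iota /= add0n => im.
(* A nonzero coefficient off the set occurs in the ordering, at a position at least [m]. *)
have [->|ck] := eqVneq (coefun e k x) 0; first by rewrite normr0.
have [j _ kj] := supp _ ck; rewrite -kj; apply: mono.
rewrite ltnW // (leq_trans im) // leqNgt; apply: contra kG => jm.
by apply/imfsetP; exists j => //=; rewrite mem_iota.
Qed.

End Coefficients.

(** * Distances and approximation errors *)

Lemma inf_ge0 (R : realType) (E : set R) : (forall r, E r -> 0 <= r) -> 0 <= inf E.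
Proof.
move=> E0; have [->|/set0P En0] := eqVneq E set0%classic; first by rewrite inf0.
exact: lb_le_inf.
Qed.

Section Errors.
Context {R : realType} {X : completeNormedModType R} (e : nat -> X).
Implicit Types (x y : X) (A : {fset nat}) (m : nat) (eta : nat -> R).

Lemma dist_set_ge0 x (Y : set X) : 0 <= dist_set x Y.
Proof. by apply: inf_ge0 => _ [y _ <-]. Qed.

Lemma dist_set_le x y (Y : set X) : Y y -> dist_set x Y <= `|x - y|.
Proof.
by move=> Yy; apply: ge_inf; [exists 0 => _ [z _ <-] | exists y].
Qed.

Lemma lspan0 (Y : set X) : lspan Y 0.
Proof. by exists 0%N, (fun=> 0), (fun=> 0); split=> [[]|] //; rewrite big_ord0. Qed.

Lemma le_dist_lspan (b : R) x (Y : set X) :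
  (forall y, lspan Y y -> b <= `|x - y|) -> b <= dist_set x (lspan Y).
Proof.
move=> bY; apply: lb_le_inf; last by move=> _ [y Yy <-]; exact: bY.
by exists `|x - 0|, 0 => //; exact: lspan0.
Qed.

Lemma D_err_le m x A eta (t : R) : (#|` A| <= m)%N -> sign_family A eta ->
  D_err e m x <= `|x - t *: signed_sum e eta A|.
Proof.
move=> Am sA; apply: (@le_trans _ _ (dist_set x (lspan [set signed_sum e eta A]))).
  by apply: ge_inf; [exists 0 => _ [B [s [_ _ ->]]]; exact: dist_set_ge0 | exists A, eta].
apply: dist_set_le; exists 1%N, (fun=> t), (fun=> signed_sum e eta A).
by rewrite big_ord1.
Qed.

Lemma lspan_signed_sum A A' eta y : A `<=` A' ->
  lspan [set signed_sum e eta A] y -> lspan [set e n | n in [set` A']] y.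
Proof.
move=> AA' [k [a [v [vE ->]]]].
pose b n := (\sum_i a i) * (if n \in A then eta n else 0).
exists #|` A'|, (fun i => b (nth 0%N A' i)), (fun i => e (nth 0%N A' i)).
split=> [i|]; first by exists (nth 0%N A' i) => //=; rewrite mem_nth.
under eq_bigr do rewrite vE.
rewrite -scaler_suml -(big_mkord xpredT (fun i => b (nth 0%N A' i) *: e (nth 0%N A' i))).
rewrite -(big_nth 0%N xpredT (fun n => b n *: e n)).
rewrite (big_fsetID _ (mem A)) /= [X in _ + X]big1_fset ?addr0; last first.
  by move=> n; rewrite !inE /= => /andP[_ /negPf nA] _; rewrite /b nA mulr0 scale0r.
rewrite scaler_sumr; have -> : [fset n in A' | n \in A] = A.
  apply/fsetP => n; rewrite !inE /=; case: (boolP (n \in A)); rewrite ?andbF ?andbT //.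
  exact: (fsubsetP AA').
by apply: eq_big_seq => n nA; rewrite /b nA scalerA.
Qed.

(** [D_err] admits sets of at most [m] indices, [sigma_err] only sets of exactly [m]; enlarging the
    set bridges the two. *)
Lemma exists_fset_card A m : (#|` A| <= m)%N ->
  exists2 A' : {fset nat}, A `<=` A' & #|` A'| = m.
Proof.
move=> /subnK <-; elim: (m - _)%N => [|k [A' AA' cA']]; first by exists A.
have [n nA'] := exists_notin_fset A'.
exists (n |` A'); last by rewrite cardfsU1 nA' cA'.
by rewrite (fsubset_trans AA') // fsubsetU1.
Qed.

Lemma sigma_err_le_D_err m x : sigma_err e m x <= D_err e m x.
Proof.
apply: lb_le_inf.
  by exists (dist_set x (lspan [set signed_sum e (fun=> 0) fset0])), fset0, (fun=> 0).
move=> _ [A [eta [/exists_fset_card[A' AA' cA'] _ ->]]].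
apply: (@le_trans _ _ (dist_set x (lspan [set e n | n in [set` A']]))).
  by apply: ge_inf; [exists 0 => _ [B _ <-]; exact: dist_set_ge0 | exists A'].
apply: le_dist_lspan => y /(lspan_signed_sum AA'); exact: dist_set_le.
Qed.

Lemma le_sigma_err (b : R) m x :
  (forall A y, #|` A| = m -> lspan [set e n | n in [set` A]] y -> b <= `|x - y|) ->
  b <= sigma_err e m x.
Proof.
move=> bA; apply: lb_le_inf.
  have [A _ cA] := @exists_fset_card fset0 m isT.
  by exists (dist_set x (lspan [set e n | n in [set` A]])), A.
by move=> _ [A cA <-]; apply: le_dist_lspan => y /(bA _ _ cA).
Qed.

(** A convex function on a cube is bounded by its values at the vertices. By induction on [s], one
    coordinate at a time is written as a convex combination of [t] and [- t]. *)
Lemma le_norm_cube (u : X) (M t : R) (s : seq nat) (a : nat -> R) : uniq s ->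
  (forall n, n \in s -> `|a n| <= t) ->
  (forall eta, (forall n, n \in s -> eta n = 1 \/ eta n = -1) ->
    `|u + t *: (\sum_(n <- s) eta n *: e n)| <= M) ->
  `|u + \sum_(n <- s) a n *: e n| <= M.
Proof.
elim: s u => [|k s ih] u /= us at_ uM.
  by have := uM (fun=> 1); rewrite !big_nil scaler0; apply.
have /andP[ks {}us] := us; have atk := at_ k (mem_head _ _).
rewrite big_cons addrA; apply: ih => // [n ns|eta etas].
  by apply: at_; rewrite inE ns orbT.
have uMk (c : R) : c = 1 \/ c = -1 ->
    `|u + (t * c) *: e k + t *: (\sum_(n <- s) eta n *: e n)| <= M.
  move=> c1; pose eta' n := if n == k then c else eta n.
  have := uM eta'; rewrite big_cons /eta' eqxx scalerDr scalerA addrA.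
  rewrite (eq_big_seq (fun n => eta n *: e n)); first apply.
    by move=> n; rewrite inE; case: eqP => //= _; exact: etas.
  by move=> n ns; case: eqP => // nk; rewrite -nk ns in ks.
have := uMk 1 (or_introl erefl); have := uMk (-1) (or_intror erefl).
rewrite mulrN1 mulr1; set w := t *: \sum_(n <- s) _ => Mm Mp.
have t0 : 0 <= t := le_trans (normr_ge0 _) atk.
(* The weight below divides by [t], so the degenerate cube is treated apart. *)
have [t_eq0|tN0] := eqVneq t 0.
  move: atk; rewrite t_eq0 normr_le0 => /eqP ->.
  by move: Mp; rewrite t_eq0.
have tp : 0 < t by rewrite lt_def tN0.
have /andP[r_ge r_le] : -1 <= a k / t <= 1.
  by rewrite -ler_norml normrM normfV (gtr0_norm tp) ler_pdivrMr // mul1r.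
have [l [l_ge0 l_le1 ->]] : exists l, [/\ 0 <= l, 0 <= 1 - l
    & a k = l * t + (1 - l) * - t].
  (* This weight solves [a k = (2 * l - 1) * t]. *)
  by exists ((1 + a k / t) / 2); split; [lra | lra | field].
have convE (p v q : X) : p + (l * t + (1 - l) * - t) *: v + q =
    l *: (p + t *: v + q) + (1 - l) *: (p + - t *: v + q).
  rewrite !(addrAC p _ q) !(scalerDr _ (p + q)) addrACA -scalerDl !scalerA -scalerDl.
  by rewrite [l + _]addrC subrK scale1r.
rewrite convE.
apply: le_trans (ler_normD _ _) _; rewrite !normrZ !ger0_norm //.
have -> : M = l * M + (1 - l) * M by rewrite -mulrDl addrC subrK mul1r.
by apply: lerD; exact: ler_wpM2l.
Qed.

End Errors.

(** * From PCCG to the greedy inequality *)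

Section PCCGGreedy.
Context {R : realType} {X : completeNormedModType R} (e : nat -> X).
Hypotheses (eB : schauder_basis e) (e1 : normalized e).
Variable D : R.
Hypothesis D0 : 0 < D.
Hypothesis DP : forall x m (G : {fset nat}), (0 < m)%N ->
    greedy_set e x m G -> `|x - projset e G x| <= D * D_err e m x.
Implicit Types (x y : X) (A G : {fset nat}) (m : nat) (eta : nat -> R).

(** The constant is [1 + D] rather than [D] to cover [m = 0], about which PCCG says nothing: both
    sets are then empty and the factor 1 suffices. *)
Lemma PCCG_le x m G A eta (t : R) : greedy_set e x m G ->
  (#|` A| <= m)%N -> sign_family A eta ->
  `|x - projset e G x| <= (1 + D) * `|x - t *: signed_sum e eta A|.
Proof.
move=> gG Am sA; have [m0|m_gt0] := posnP m.
  move: gG Am => [+ _]; rewrite m0 leqn0 => /eqP.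
  rewrite !cardfs_eq0 => /eqP -> /eqP ->.
  rewrite /projset /signed_sum !big_seq_fset0 scaler0 subr0 mulrDl mul1r lerDl.
  by rewrite mulr_ge0 // ltW.
apply: le_trans (DP m_gt0 gG) _.
apply: (@le_trans _ _ (D * `|x - t *: signed_sum e eta A|)).
  by rewrite ler_pM2l //; exact: D_err_le.
by rewrite ler_wpM2r // lerDr.
Qed.

Lemma PCCG_suppression x A : `|x - projset e A x| <= (1 + D) * `|x|.
Proof.
have [M M0 xM] := coefun_bounded eB e1 x.
(* Adding twice the bound [M] lifts every coefficient on [A] to at least [M], so [A] is greedy for
   [y], while the part off [A] is unchanged. *)
pose y := x + (M *+ 2) *: signed_sum e (fun=> 1) A.
have cy n : coefun e n y = coefun e n x + if n \in A then M *+ 2 else 0.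
  rewrite coefunD // coefunZ // coefun_signed_sum //.
  by case: ifP => _; rewrite ?mulr1 ?mulr0.
have -> : x - projset e A x = y - projset e A y.
  apply: (coefun_inj eB) => n; rewrite !coefunB // !coefun_projset // !cy.
  by case: ifP => _; rewrite ?addr0 ?subrr.
rewrite -[in leRHS](addrK ((M *+ 2) *: signed_sum e (fun=> 1) A) x).
apply: (@PCCG_le _ #|` A|) => //; last by move=> ? _; left.
split=> // n k nA kA; rewrite !cy nA (negPf kA) addr0.
apply: le_trans (xM k) _; have := xM n; rewrite ler_norml => /andP[xn _].
by apply: le_trans (ler_norm _); rewrite mulr2n; lra.
Qed.

(** One factor [1 + D] comes from [PCCG_suppression], the other from [PCCG_le] applied to [w]. *)
Lemma PCCG_le_lspan x m G A y : greedy_set e x m G -> #|` A| = m ->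
  lspan [set e n | n in [set` A]] y ->
  `|x - projset e G x| <= (1 + D) ^+ 2 * `|x - y|.
Proof.
move=> gG cA [k [a [v [vA yE]]]].
have cy n : n \notin A -> coefun e n y = 0.
  move=> nA; rewrite yE coefun_sum // big1 // => i _.
  have [j /= jA <-] := vA i; rewrite coefunZ // coefun_basis //.
  by case: eqP => [nj|_]; [rewrite nj jA in nA | rewrite mulr0].
have xyA : x - projset e A x = (x - y) - projset e A (x - y).
  apply: (coefun_inj eB) => n; rewrite !coefunB // !coefun_projset // !coefunB //.
  by case: ifPn => nA; rewrite ?subrr // cy // !subr0.
have suppA : `|x - projset e A x| <= (1 + D) * `|x - y|.
  by rewrite xyA; exact: PCCG_suppression.
have cGA : #|` G `\` A| = #|` A `\` G|.
  by rewrite !cardfsD gG.1 cA fsetIC.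
(* For empty [G] the infimum defaults to 0 and need not bound the other coefficients; but [A] is
   then empty too. *)
have [t tG xt] : exists2 t, (forall n, n \in G -> t <= `|coefun e n x|) &
    (forall n, n \notin G -> `|coefun e n x| <= t \/ G = fset0).
  exists (inf [set `|coefun e n x| | n in [set` G]]) => n nG.
    by apply: ge_inf; [exists 0 => _ [j _ <-] | exists n].
  have [->|[i iG]] := fset_0Vmem G; first by right.
  left; apply: lb_le_inf; first by exists `|coefun e i x|, i.
  by move=> _ [j jG <-]; exact: gG.2.
have -> : x - projset e G x = (x - projset e (A `|` G) x)
    + projset e (A `\` G) x.
  apply: (coefun_inj eB) => n.
  rewrite !(coefunB eB, coefunD eB) !coefun_projset // !inE.
  by case: (n \in A); case: (n \in G); rewrite /= ?subrr ?addr0 ?subr0 ?add0r.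
(* The coefficients of [x] on [A] minus [G] are at most [t] in modulus, so they may be replaced by
   [t] times signs. *)
rewrite {2}/projset; apply: (@le_norm_cube _ _ _ _ _ t) => [|n|eta eta1]; first exact: fset_uniq.
  rewrite !inE => /andP[nG nA]; case: (xt n nG) => // G0.
  have: A = fset0 by apply/eqP; rewrite -cardfs_eq0 cA -gG.1 G0 cardfs0.
  by move=> A0; rewrite A0 inE in nA.
pose w := x - projset e A x + t *: signed_sum e eta (A `\` G).
have cw n : coefun e n w = if n \in A then if n \in G then 0 else t * eta n
                           else coefun e n x.
  rewrite coefunD // coefunB // coefunZ // coefun_projset // coefun_signed_sum // !inE.
  by case: (n \in A); case: (n \in G); rewrite /= ?subrr ?mulr0 ?addr0 ?subr0 ?add0r.
have wE : w - t *: signed_sum e eta (A `\` G) = x - projset e A x by rewrite addrK.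
move: w cw wE => w cw wE.
have -> : x - projset e (A `|` G) x + t *: (\sum_(n <- A `\` G) eta n *: e n)
    = w - projset e (G `\` A) w.
  apply: (coefun_inj eB) => n.
  rewrite !(coefunB eB, coefunD eB) coefunZ // !coefun_projset // coefun_lincomb // cw !inE.
  by case: (n \in A); case: (n \in G); rewrite /= ?subrr ?mulr0 ?addr0 ?subr0 ?add0r.
apply: (@le_trans _ _ ((1 + D) * `|w - t *: signed_sum e eta (A `\` G)|)).
  (* Elsewhere the coefficients of [w] are 0, of modulus [t], or coefficients of [x] off [G]; none
     exceeds in modulus those of [x] on [G]. *)
  apply: (@PCCG_le _ #|` G `\` A|) => //; last by rewrite cGA.
  split=> // n j; rewrite !cw !inE => /andP[/negPf nA nG] jGA.
  rewrite nA; case: ifPn => jA.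
    case: ifPn => jG; first by rewrite normr0.
    have jAG : j \in A `\` G by rewrite !inE jA jG.
    have t0 : 0 <= t.
      case: (xt j jG) => [|G0]; first exact: le_trans.
      by rewrite G0 inE in nG.
    rewrite normrM (ger0_norm t0).
    by have [->|->] := eta1 j jAG; rewrite ?normrN normr1 mulr1; exact: tG.
  by apply: gG.2 => //; rewrite jA in jGA.
by rewrite wE expr2 -mulrA ler_pM2l ?addr_gt0.
Qed.

End PCCGGreedy.

Theorem corollary1p5 (R : realType) (X : completeNormedModType R)
    (e : nat -> X) :
  infinite_dimensional X -> schauder_basis e -> normalized e ->
  (PCCG e <-> greedy e).
Proof.
move=> _ eB e1; split=> [[D D0 DP]|[C CP]].
  exists ((1 + D) ^+ 2) => x m rho m0 /(greedy_ordering_set m)[G gG ->].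
  have D2 : 0 < (1 + D) ^+ 2 by rewrite exprn_gt0 // addr_gt0.
  (* Dividing by the constant isolates the infimum, so that a bound for each competitor [y]
     suffices. *)
  rewrite mulrC -ler_pdivrMr //; apply: le_sigma_err => A y cA Ay.
  by rewrite ler_pdivrMr // mulrC; exact: (PCCG_le_lspan eB e1 D0 DP gG cA Ay).
(* PCCG asks for a positive constant, whereas [C] may have any sign. *)
exists (`|C| + 1) => [|x m G m0 gG]; first by rewrite ltr_wpDl.
have [rho rhoP <-] := greedy_set_ordering eB e1 gG.
have s0 : 0 <= sigma_err e m x by apply: inf_ge0 => _ [A _ <-]; exact: dist_set_ge0.
apply: le_trans (CP x m rho m0 rhoP) _.
apply: (@le_trans _ _ ((`|C| + 1) * sigma_err e m x)).
  by rewrite ler_wpM2r // (le_trans (ler_norm _)) // lerDl.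
by rewrite ler_wpM2l ?sigma_err_le_D_err // addr_ge0.
Qed.
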